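(* Let $X$ be a set and let $\mathcal H\subset\mathbb R^X$ consist of bounded functions. Let $\mathscr Z$ be a family of subsets of $X$, linearly ordered by inclusion. Then $Z\succeq_{\mathcal H}X$ for every $Z\in\mathscr Z$ if and only if for each $x\in X$ there exists $m_x\in\mathbb P(X;\mathcal H)$ such that $m_x(Z^c)=0$ for all $Z\in\mathscr Z$ and $$h(x)\le\int h(y)\,m_x(dy)\qquad\text{for all }h\in\mathcal H.$$
   Context: All underlying sets on which functions or probabilities are considered are non-empty. $\mathbb R^X$ is the set of all real-valued functions on $X$. $\mathbb P(X;\mathcal H)$ is the set of finitely additive probabilities $m$ on the power set of $X$ such that every $h\in\mathcal H$ is $m$-integrable (Dunford–Schwartz integral). $Z^c=X\setminus Z$. $\Delta(\mathcal H)$ is the set of functions $\delta:\mathcal H\to\mathbb R_+$ with finite support such that $\sum_{h\in\mathcal H}\delta(h)=1$. A subset $Z\subset X$ is sufficient for $X$ relatively to $\mathcal H$, written $Z\succeq_{\mathcal H}X$, if $$\sum_{h\in\mathcal H}\delta(h)h(x)\le\sup_{z\in Z}\sum_{h\in\mathcal H}\delta(h)h(z)\qquad\text{for all }x\in X,\ \delta\in\Delta(\mathcal H).$$ *)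

(* Defs.v *)
From HB Require Import structures.
From mathcomp Require Import all_boot all_order all_algebra.
From mathcomp Require Import all_classical all_reals all_analysis.

Set Implicit Arguments.
Unset Strict Implicit.
Unset Printing Implicit Defensive.

Import Order.TTheory GRing.Theory Num.Theory.
Import numFieldNormedType.Exports.
Local Open Scope classical_set_scope.
Local Open Scope ring_scope.

(* A copy of X carrying its full power set as the algebra of measurable sets,
   so that {content set (powersetType X) -> \bar R} is the type of
   nonnegative finitely additive set functions on the power set of X. *)
Definition powersetType (X : Type) : Type := X.

HB.instance Definition _ (X : pointedType) :=
  Pointed.copy (powersetType X) X.

HB.instance Definition _ (X : pointedType) :=
  @isMeasurable.Build default_measure_display (powersetType X)
    discrete_measurable discrete_measurable0
    discrete_measurableC discrete_measurableU.

Section dunford_schwartz.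
Context {X : pointedType} {R : realType}.
Implicit Types (m : set X -> \bar R) (f : nat -> {fimfun X >-> R}) (h : X -> R).

(* f is a sequence of simple functions converging to h in m-measure and Cauchy
   in mean. As every subset of X is measurable, a simple function is just a
   function of finite range and the outer measure induced by m is m itself. *)
Definition ds_determining m f h :=
  (forall e : R, 0 < e ->
     m [set x | e < `|f n x - h x|] @[n --> \oo] --> 0%E) /\
  (forall e : R, 0 < e ->
     \forall n & k \near \oo,
       (sintegral m (fun x => `|f n x - f k x|%R) < e%:E)%E).

Definition ds_integrable m h := exists f, ds_determining m f h.

(* The limit of the integrals of any determining sequence; for m finite and
   finitely additive it does not depend on the sequence. The default value 0
   is only taken when h is not m-integrable. *)
Definition ds_integral m h : R :=
  xget 0 [set I : R | exists2 f, ds_determining m f h &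
                      sintegral m (f n) @[n --> \oo] --> I%:E].

End dunford_schwartz.

Section sufficiency.
Context {X : pointedType} {R : realType}.
Implicit Types (H : set (X -> R)) (Z : set X).

Definition fa_probability H : set {content set (powersetType X) -> \bar R} :=
  [set m | m [set: X] = 1%E /\ forall h, H h -> ds_integrable m h].

(* Weights are functions on all of R^X, but only their values on H matter. *)
Definition weights H : set ((X -> R) -> R) :=
  [set delta | [/\ forall h, H h -> 0 <= delta h,
                   finite_set [set h | H h /\ delta h != 0] &
                   \sum_(h \in H) delta h = 1]].

(* The supremum is taken in \bar R; in particular it is -oo when Z is empty. *)
Definition sufficient H Z :=
  forall (x : X) (delta : (X -> R) -> R), weights H delta ->
    ((\sum_(h \in H) delta h * h x)%R%:E <=
     ereal_sup [set (\sum_(h \in H) delta h * h z)%R%:E | z in Z])%E.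

End sufficiency.

(* Main.v *)
Require Import Defs.
From HB Require Import structures.
From mathcomp Require Import all_boot all_order all_algebra finmap.
From mathcomp Require Import all_classical all_reals all_analysis.
From mathcomp Require Import lra.

Import Order.TTheory GRing.Theory Num.Theory.
Import numFieldNormedType.Exports.
Local Open Scope classical_set_scope.
Local Open Scope ring_scope.

(* If the measures m_x exist, integrate a convex combination of functions of H
   with respect to m_x, which is carried by Z.

   Conversely, fix x and adjoin the whole space to the chain. On simple functions
   u let p(u) be the infimum, over Z in the chain and k in the cone generated by
   the functions h - h(x), of sup_Z (u + k). Sufficiency says exactly that
   sup_Z k >= 0, so p is finite, and p is subadditive because the family is a
   chain. By Hahn-Banach p dominates a linear functional phi, and
   m_x(A) = phi(1_A) works: phi(1_{Z^c}) <= p(1_{Z^c}) <= 0, and if g is simple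
   with h <= g, then phi(-g) <= p(-g) <= sup (-g + h - h(x)) <= - h(x). *)

(** * Sublinear functionals *)

Section sublinear.
Context {R : realType} {V : lmodType R}.
Implicit Types p q : V -> R.

(** Only the inequality for positive scalars is asked, the half that an infimum inherits directly.
    Applying it to [c^-1] as well gives equality, see [sublinearZ]. *)
Definition sublinear p :=
  (forall u v, p (u + v) <= p u + p v) /\
  (forall c u, 0 < c -> p (c *: u) <= c * p u).

Lemma sublinear0 p : sublinear p -> p 0 = 0.
Proof.
move=> [pD pZ]; apply/eqP; rewrite eq_le; apply/andP; split.
  have := @pZ (1/2) 0 ltac:(lra); rewrite scaler0; lra.
have := pD 0 0; rewrite addr0; lra.
Qed.

Lemma sublinear_geN p v : sublinear p -> - p (- v) <= p v.
Proof. by move=> sp; have := sp.1 v (- v); rewrite subrr sublinear0//; lra. Qed.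

Lemma sublinearZ p c v : sublinear p -> 0 <= c -> p (c *: v) = c * p v.
Proof.
move=> sp; rewrite le_eqVlt => /orP[/eqP<-|c0].
  by rewrite scale0r mul0r sublinear0.
apply/eqP; rewrite eq_le sp.2//=.
have ci : 0 < c^-1 by rewrite invr_gt0.
have := sp.2 c^-1 (c *: v) ci; rewrite scalerA mulVf ?gt_eqF// scale1r.
by rewrite ler_pdivlMl.
Qed.

(** Since [- p (- v) <= p v] always holds, the hypothesis makes [p] odd. Oddness turns subadditivity
    for [(u + v) + (- v)] into superadditivity. *)
Lemma sublinear_linear p : sublinear p -> (forall v, p (- v) <= - p v) ->
  forall c u v, p (c *: u + v) = c * p u + p v.
Proof.
move=> sp po.
have pN v : p (- v) = - p v.
  by apply/eqP; rewrite eq_le po/= lerNl sublinear_geN.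
have pD u v : p (u + v) = p u + p v.
  apply/eqP; rewrite eq_le sp.1/=.
  have := sp.1 (u + v) (- v); rewrite addrK pN; lra.
move=> c u v; rewrite pD; congr (_ + _).
have [c0|c0] := leP 0 c; first exact: sublinearZ.
by rewrite -[c]opprK scaleNr pN sublinearZ ?mulNr// oppr_ge0 ltW.
Qed.

(** Provides the lower bounds of chains for Zorn's lemma. The infimum is finite because
    [q v >= - q (- v) >= - p (- v)], and subadditive because the smaller of two members of the chain
    serves for both arguments. *)
Lemma sublinear_inf (A : set (V -> R)) p : A !=set0 ->
  (forall q, A q -> sublinear q) -> (forall q v, A q -> q v <= p v) ->
  total_on A (fun q r => forall v, r v <= q v) ->
  let i := fun v => inf [set q v | q in A] in
  sublinear i /\ forall q v, A q -> i v <= q v.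
Proof.
move=> [q0 Aq0] As Ap At i.
have lbi v : has_lbound [set q v | q in A].
  exists (- p (- v)) => _ [q Aq <-].
  by rewrite (le_trans _ (sublinear_geN _ v (As _ Aq)))// lerN2 Ap.
have iq q v : A q -> i v <= q v by move=> Aq; apply: ge_inf => //; exists q.
have ne v : nonempty [set q v | q in A] by exists (q0 v), q0.
split=> //; split.
  move=> u v; rewrite -lerBlDl; apply: lb_le_inf => // _ [q Aq <-].
  rewrite lerBlDl -lerBlDr; apply: lb_le_inf => // _ [r Ar <-].
  rewrite lerBlDr.
  have [qr|rq] := At q r Aq Ar.
    by rewrite (le_trans (iq _ _ Ar))// (le_trans ((As _ Ar).1 _ _))// lerD2l.
  by rewrite (le_trans (iq _ _ Aq))// (le_trans ((As _ Aq).1 _ _))// lerD2r.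
move=> c u c0; rewrite -ler_pdivrMl//; apply: lb_le_inf => // _ [q Aq <-].
by rewrite ler_pdivrMl// -(sublinearZ _ _ _ (As _ Aq) (ltW c0)) iq.
Qed.

(* A minimal [q] must coincide with the sublinear minorant [r], and then
   [q (- v) <= - q v] makes [q] linear. *)
Lemma sublinear_shift q v : sublinear q ->
  let r := fun u => inf [set q (u + t *: v) - t * q v | t in [set t | 0 <= t]] in
  [/\ sublinear r, forall u, r u <= q u & r (- v) <= - q v].
Proof.
move=> sq r.
have lbr u : has_lbound [set q (u + t *: v) - t * q v | t in [set t | 0 <= t]].
  (* From [t * q v = q (t *: v) <= q (u + t *: v) + q (- u)]. *)
  exists (- q (- u)) => _ [t /= t0 <-].
  by have := sq.1 (u + t *: v) (- u); rewrite addrAC subrr add0r sublinearZ//; lra.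
have rq u t : 0 <= t -> r u <= q (u + t *: v) - t * q v.
  by move=> t0; apply: ge_inf => //; exists t.
have ne u : nonempty [set q (u + t *: v) - t * q v | t in [set t | 0 <= t]].
  by exists (q (u + 0 *: v) - 0 * q v), 0 => /=.
split; last 2 first.
- by move=> u; have := rq u 0 (lexx _); rewrite scale0r addr0 mul0r subr0.
(* At [- v] the parameter [t = 1] gives [q 0 - q v]. *)
- by have := rq (- v) 1 ler01; rewrite scale1r addNr sublinear0//; lra.
split.
  move=> u w; rewrite -lerBlDl; apply: lb_le_inf => // _ [t /= t0 <-].
  rewrite lerBlDl -lerBlDr; apply: lb_le_inf => // _ [s /= s0 <-].
  have := rq (u + w) (s + t) ltac:(lra).
  have := sq.1 (u + s *: v) (w + t *: v).
  by rewrite scalerDl addrACA; lra.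
move=> c u c0; rewrite -ler_pdivrMl//; apply: lb_le_inf => // _ [t /= t0 <-].
rewrite ler_pdivrMl// mulrBr -(sublinearZ q c _ sq (ltW c0)) scalerDr scalerA mulrA.
by apply: rq; exact: mulr_ge0 (ltW c0) t0.
Qed.

(** Instead of extending a functional from subspaces, Zorn's lemma picks a minimal sublinear
    functional below [p]; [sublinear_shift] shows that it is linear. *)
Lemma hahn_banach p : sublinear p ->
  exists phi : V -> R, (forall c u v, phi (c *: u + v) = c * phi u + phi v) /\
    forall v, phi v <= p v.
Proof.
move=> sp.
pose T := {q : V -> R | sublinear q /\ forall v, q v <= p v}.
(* The order is reversed, so a maximal element is a pointwise minimal functional. *)
pose le (q r : T) : bool := `[< forall v, sval r v <= sval q v >].
have [||A At|q qmax] := @ZL_preorder T (exist _ p (conj sp (fun v => lexx _))) le.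
- by move=> q; apply/asboolP.
- move=> r q s /asboolP qr /asboolP qs; apply/asboolP => v.
  exact: le_trans (qr v).
- have [[q Aq]|A0] := pselect (A !=set0); last first.
    exists (exist _ p (conj sp (fun v => lexx _))) => s As.
    by exfalso; apply: A0; exists s.
  have [||||si ip] := @sublinear_inf (sval @` A) p.
  + by exists (sval q), q.
  + by move=> _ [r Ar <-]; exact: (svalP r).1.
  + by move=> _ v [r Ar <-]; exact: (svalP r).2.
  + move=> _ _ [r Ar <-] [s As <-].
    by have [/asboolP|/asboolP] := At _ _ Ar As; [left|right].
  unshelve eexists (exist _ (fun v => inf [set q v | q in sval @` A]) _).
    split=> // v; apply: le_trans ((svalP q).2 v).
    by apply: ip; exists q.
  by move=> s As; apply/asboolP => v; apply: ip; exists s.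
exists (sval q); split; last exact: (svalP q).2.
apply: sublinear_linear => [|v]; first exact: (svalP q).1.
have [sr rq rv] := sublinear_shift _ v (svalP q).1.
have := qmax (exist _ _ (conj sr (fun u => le_trans (rq u) ((svalP q).2 u)))).
move=> /(_ _)/asboolP /= H.
by apply: le_trans rv; apply: H; apply/asboolP.
Qed.

End sublinear.

(** * The vector space of simple functions *)

Section fimfun_lmod.
Context {X : Type} {R : realType}.

Lemma fimfun_scaler_closed (c : R) :
  {in @fimfun X R, forall f, c *: (f : X -> R) \in @fimfun X R}.
Proof.
by move=> f; rewrite !inE/= => fA; exact: (finite_image11 (fun x y => c * x) fA fA).
Qed.

HB.instance Definition _ :=
  GRing.isScaleClosed.Build R (X -> R : lmodType R) (@fimfun X R) fimfun_scaler_closed.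
HB.instance Definition _ := [SubZmodule_isSubLmodule of {fimfun X >-> R} by <:].
End fimfun_lmod.

(** * Integrals of simple functions *)

Section simple_int.
Context {X : Type} {R : realType} (mu : set X -> R).
Context (mu_ge0 : forall A, 0 <= mu A).
Context (muU : forall A B, A `&` B = set0 -> mu (A `|` B) = mu A + mu B).
Implicit Types (f g : X -> R) (A B : set X).

(** A real-valued counterpart of [sintegral], avoiding arithmetic in [\bar R];
    [sintegral_simple_int] identifies the two on functions of finite range. *)
Definition simple_int f : R :=
  \sum_(y <- fset_set (range f)) y * mu (f @^-1` [set y]).

Lemma mu_set0 : mu set0 = 0.
Proof. by have := muU set0 set0; rewrite setU0 setI0 => /(_ erefl); lra. Qed.

(** Finite additivity over the fibres of [g], by induction on [s]. The predicate [P] will select the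
    labels at which a function takes a given value. *)
Lemma mu_preimage {I : choiceType} (g : X -> I) (s : seq I) (P : pred I) :
  uniq s ->
  mu (g @^-1` [set i | P i && (i \in s)]) =
    \sum_(i <- s | P i) mu (g @^-1` [set i]).
Proof.
elim: s => [_|i s IH /=/andP[nis us]].
  rewrite big_nil [X in mu X](_ : _ = set0) ?mu_set0//.
  by apply/seteqP; split=> x //=; rewrite in_nil andbF.
rewrite big_cons -IH//; case: ifPn => Pi; last first.
  congr mu; apply/seteqP; split=> x /=.
    by rewrite inE; case: eqP => [->|//]; rewrite (negbTE Pi).
  by move=> /andP[->]; rewrite inE => ->; rewrite orbT.
rewrite -muU; last first.
  apply/seteqP; split=> x //= [] ->; by rewrite (negbTE nis) andbF.
congr mu; apply/seteqP; split=> x /=.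
  by rewrite inE => /andP[Px /orP[/eqP|xs]]; [left|right; rewrite Px].
by case=> [->|/andP[-> xs]]; rewrite inE ?eqxx ?Pi// xs orbT.
Qed.

(** The integral can be computed on any finite partition that refines the level sets: group the
    labels by their value under [F] and exchange the two sums. *)
Lemma simple_int_comp {I : choiceType} (g : X -> I) (F : I -> R) (s : seq I) :
  uniq s -> (forall x, g x \in s) ->
  simple_int (F \o g) = \sum_(i <- s) F i * mu (g @^-1` [set i]).
Proof.
move=> us gs.
have fg : finite_set (range (F \o g)).
  rewrite -(image_comp g F); apply: finite_image.
  by apply: (sub_finite_set _ (finite_seq s)) => _ [x _ <-]; exact: gs.
rewrite /simple_int; set r := fset_set _.
transitivity (\sum_(y <- r) \sum_(i <- s | F i == y) F i * mu (g @^-1` [set i])).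
  apply: eq_bigr => y _.
  rewrite [RHS](eq_bigr (fun i => y * mu (g @^-1` [set i]))); last first.
    by move=> i /eqP ->.
  rewrite -mulr_sumr -(mu_preimage _ _ (fun i => F i == y))//.
  congr (_ * mu _); apply/seteqP; split=> x /=; first by move=> ->; rewrite eqxx gs.
  by move=> /andP[/eqP].
rewrite (exchange_big_dep xpredT)//=; apply: eq_bigr => i _.
(* A label missed by [g] has an empty fibre; for any other label, [F i] occurs exactly once among
   the values. *)
have [[x gxi]|gi] := pselect (exists x, g x = i); last first.
  have -> : g @^-1` [set i] = set0.
    by apply/seteqP; split=> x //= gxi; apply: gi; exists x.
  by rewrite mu_set0 mulr0 big1.
rewrite -big_filter (eq_filter (a2 := pred1 (F i))); last first.
  by move=> y /=; rewrite eq_sym.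
rewrite filter_pred1_uniq ?fset_uniq ?big_seq1//.
by rewrite in_fset_set// inE -gxi; exists x.
Qed.

(** Puts [f], [g] and their combinations on one common partition, so that linearity and monotonicity
    become termwise statements. *)
Lemma simple_int_pair f g (F : R * R -> R) :
  finite_set (range f) -> finite_set (range g) ->
  simple_int (fun x => F (f x, g x)) =
    \sum_(p <- fset_set (range (fun x => (f x, g x))))
      F p * mu [set x | (f x, g x) = p].
Proof.
move=> ff fg; apply: (simple_int_comp (fun x => (f x, g x)) F) => // x.
by rewrite in_fset_set ?inE; [exists x|exact: (finite_image11 pair ff fg)].
Qed.

Lemma simple_intD f g : finite_set (range f) -> finite_set (range g) ->
  simple_int (f \+ g) = simple_int f + simple_int g.
Proof.
move=> ff fg; rewrite (simple_int_pair _ _ (fun p => p.1 + p.2) ff fg).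
rewrite (simple_int_pair _ _ fst ff fg) (simple_int_pair _ _ snd ff fg) -big_split/=.
by apply: eq_bigr => p _; rewrite mulrDl.
Qed.

Lemma simple_intZ c f : finite_set (range f) ->
  simple_int (fun x => c * f x) = c * simple_int f.
Proof.
move=> ff; rewrite (simple_int_pair _ _ (fun p => c * p.1) ff ff).
rewrite (simple_int_pair _ _ fst ff ff) mulr_sumr.
by apply: eq_bigr => p _; rewrite mulrA.
Qed.

Lemma le_mu A B : A `<=` B -> mu A <= mu B.
Proof.
by move=> AB; rewrite -(setDUK AB) muU ?lerDl// setDE setICA setICr setI0.
Qed.

(** On the common partition every cell with [f > g] is null, and on the others the terms compare. *)
Lemma ae_le_simple_int f g : finite_set (range f) -> finite_set (range g) ->
  mu [set x | g x < f x] = 0 -> simple_int f <= simple_int g.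
Proof.
move=> ff fg gf0.
rewrite (simple_int_pair _ _ fst ff fg) (simple_int_pair _ _ snd ff fg).
apply: ler_sum => -[y z] _ /=; have [yz|zy] := leP y z; first exact: ler_wpM2r.
rewrite (_ : mu _ = 0) ?mulr0//; apply/eqP; rewrite eq_le mu_ge0 andbT -gf0.
by apply: le_mu => x /= [-> ->].
Qed.

Lemma le_simple_int f g : finite_set (range f) -> finite_set (range g) ->
  (forall x, f x <= g x) -> simple_int f <= simple_int g.
Proof.
move=> ff fg le_fg; apply: ae_le_simple_int => //.
rewrite [X in mu X](_ : _ = set0) ?mu_set0//.
by apply/seteqP; split=> x //=; rewrite ltNge le_fg.
Qed.

Lemma simple_int_indic A : simple_int \1_A = mu A.
Proof.
rewrite (simple_int_comp (fun x => x \in A) (fun b => b%:R) [:: false; true])//.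
  rewrite !big_cons big_nil mul0r add0r mul1r addr0; congr mu.
  by apply/seteqP; split=> x /=; [move=> /set_mem|move=> /mem_set].
by move=> x; case: (_ \in _).
Qed.

Lemma simple_int_cst c : simple_int (fun=> c) = c * mu setT.
Proof.
rewrite (simple_int_comp (fun=> tt) (fun=> c) [:: tt])// big_seq1; congr (_ * mu _).
by apply/seteqP; split.
Qed.

End simple_int.

(** * Uniform approximation of bounded functions by simple ones *)

Lemma bounded_fun_bound {X : Type} {R : realType} (h : X -> R) :
  bounded_fun h -> exists2 M, 0 <= M & forall x, `|h x| <= M.
Proof.
move=> [M [Mr hM]]; exists (`|M| + 1); first by rewrite addr_ge0.
by move=> x; apply: (hM (`|M| + 1)) => //; rewrite (le_lt_trans (ler_norm M))// ltrDl.
Qed.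

(** Round [h + M], which is nonnegative, down to a multiple of [e]; boundedness leaves finitely many
    multiples. *)
Lemma simple_approx {X : Type} {R : realType} (h : X -> R) (e : R) :
  bounded_fun h -> 0 < e ->
  exists g : X -> R, finite_set (range g) /\ forall x, g x <= h x <= g x + e.
Proof.
move=> /bounded_fun_bound[M M0 hM] e0.
pose t x := Num.truncn ((h x + M) / e).
have tN x : (t x < (Num.truncn ((M + M) / e)).+1)%N.
  rewrite ltnS; apply: le_truncn; rewrite ler_pM2r ?invr_gt0// lerD2r.
  exact: le_trans (ler_norm _) (hM x).
exists (fun x => e * (t x)%:R - M); split.
  apply: (@sub_finite_set _ _ ((fun n : nat => e * n%:R - M) @`
      `I_((Num.truncn ((M + M) / e)).+1))).
    by move=> _ [x _ <-]; exists (t x) => //; exact: tN.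
  by apply: finite_image; exact: finite_II.
move=> x; have hx : 0 <= (h x + M) / e.
  apply: divr_ge0; last exact: ltW.
  by have := hM x; rewrite ler_norml; lra.
have /andP[] := truncn_itv hx; rewrite -/(t x) ler_pdivlMr// ltr_pdivrMr// -natr1.
nra.
Qed.

(** * The Dunford-Schwartz integral of bounded functions *)

Lemma finite_range_bound {X : Type} {R : realType} (f : X -> R) :
  finite_set (range f) -> exists2 M, 0 <= M & forall x, `|f x| <= M.
Proof.
move=> /finite_seqP[s fs]; exists (\sum_(y <- s) `|y|); first exact: sumr_ge0.
move=> x; have /(big_rem _) -> : f x \in s.
  by have : range f (f x) by [exists x]; rewrite fs.
by rewrite lerDl sumr_ge0.
Qed.

Section ds_integral_simple_int.
Context {X : pointedType} {R : realType} (mu : set X -> R).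
Context (mu_ge0 : forall A, 0 <= mu A).
Context (muU : forall A B, A `&` B = set0 -> mu (A `|` B) = mu A + mu B).
Context (muT : mu setT = 1).
Implicit Types (f : nat -> {fimfun X >-> R}) (g h : X -> R).

Let m : set X -> \bar R := fun A => (mu A)%:E.
Let finite_range_fimfun (f : {fimfun X >-> R}) : finite_set (range f).
Proof. exact: fimfun_inP. Qed.
Let muS := le_simple_int mu mu_ge0 muU.

Lemma sintegral_simple_int g : finite_set (range g) ->
  sintegral m g = (simple_int mu g)%:E.
Proof.
move=> fg; rewrite /sintegral -(@fsbig_widen _ _ _ _ (range g))//.
  by rewrite fsbig_finite//= /simple_int -sumEFin.
move=> y [_ ny] /=; rewrite preimage10 /m ?(mu_set0 mu muU) ?mule0//.
Qed.

(* The functions [f n] need not be uniformly bounded, so where [f n] is far from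
   [h] it is compared with a fixed [f N] by means of the Cauchy condition. *)
Lemma ds_determining_error f h C e : ds_determining m f h -> 0 < e ->
  \forall n \near \oo, exists r : X -> R,
    [/\ finite_set (range r), simple_int mu r <= e &
      forall x a, `|a| <= C -> (a <= h x -> a <= f n x + r x) /\
                               (h x <= a -> f n x <= a + r x)].
Proof.
move=> [fh fC] e0; have e3 : 0 < e / 3 by lra.
have [N fN] : exists N, forall n, (N <= n)%N ->
    simple_int mu (fun x => `|f n x - f N x|) < e / 3.
  have [[A B] [/= [N1 _ A1] [N2 _ B2]] AB] := fC _ e3.
  exists (maxn N1 N2) => n; rewrite geq_max => /andP[n1 n2].
  have /= := AB (n, maxn N1 N2); rewrite sintegral_simple_int ?lte_fin; first apply.
    by split; [apply: A1|apply: B2 => /=; rewrite leq_maxr].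
  exact: (finite_image11 (fun x y : R => `|x - y|)).
have [M M0 fM] := finite_range_bound _ (finite_range_fimfun (f N)).
pose D := `|C| + M.
have D0 : 0 <= D by rewrite addr_ge0.
(* The exceptional set will be charged [D] per unit of mass, hence a mass below [e / 3 / (D + 1)];
   the [+ 1] avoids dividing by zero. *)
have eD : 0 < e / 3 / (D + 1) by rewrite divr_gt0//; lra.
have /fine_cvg/cvgrPdist_lt/(_ _ eD) /= := fh _ e3.
move=> small; near=> n.
have muA : mu [set x | e / 3 < `|f n x - h x|] * (D + 1) < e / 3.
  rewrite -ltr_pdivlMr; last lra.
  rewrite -[X in X < _]ger0_norm// -normrN -sub0r; near: n; exact: small.
set A := [set x | e / 3 < `|f n x - h x|] in muA *.
have fnN : simple_int mu (fun x => `|f n x - f N x|) < e / 3.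
  by apply: fN; near: n; exact: nbhs_infty_ge.
have f1 : finite_set (range (fun x => `|f n x - f N x|)).
  exact: (finite_image11 (fun x y : R => `|x - y|)).
have f2 : finite_set (range (\1_A : X -> R)) by exact: finite_range_fimfun.
have f3 : finite_set (range (fun x => D * \1_A x : R)).
  exact: (finite_image11 (fun x y => D * x) f2 f2).
have f4 := finite_image11 +%R f3 f1.
have f5 : finite_set (range (fun _ : X => e / 3)) by exact: (finite_image_cst (e / 3)).
have f6 := finite_image11 +%R f5 f4.
(* Off [A] the error is at most [e / 3]. On [A], [D] covers both [a] and the bound [M] on [f N], and
   the last term covers the passage from [f N] to [f n]. *)
exists (fun x => e / 3 + (D * \1_A x + `|f n x - f N x|)); split => //.
  rewrite (simple_intD mu muU _ _ f5 f4) (simple_intD mu muU _ _ f3 f1).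
  rewrite (simple_intZ mu muU D _ f2) (simple_int_indic mu muU).
  rewrite (simple_int_cst mu muU) muT.
  have := mu_ge0 A; nra.
move=> x a aC; have := fM x; have := normr_ge0 (f n x - f N x).
have := ler_norm C.
rewrite indicE; have [xA|xA] := boolP (x \in A).
  have := ler_norm (f n x - f N x); have := ler_norm (f N x - f n x).
  move: aC; rewrite distrC !ler_norml mulr1 /D => /andP[? ?] ? ? ? ? /andP[? ?].
  by split=> _; lra.
have : `|f n x - h x| <= e / 3.
  by rewrite leNgt; apply/negP => xA'; move/negP: xA; apply; exact/mem_set.
rewrite !ler_norml mulr0 => /andP[? ?] ? ? /andP[? ?].
by split=> ?; lra.
Unshelve. all: by end_near. Qed.

(** For large [n] the simple function [f n + r] dominates [g], and its integral is at most [I + e].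
    Every determining sequence is allowed, as [ds_integral] selects its value by [xget]. *)
Lemma ds_limit_ge f h g I : ds_determining m f h ->
  sintegral m (f n) @[n --> \oo] --> I%:E -> finite_set (range g) ->
  (forall x, g x <= h x) -> simple_int mu g <= I.
Proof.
move=> fh fI fg gh; have [M M0 gM] := finite_range_bound _ fg.
apply/ler_addgt0Pr => e e0; have e2 : 0 < e / 2 by lra.
move/fine_cvg/cvgrPdist_lt : fI => /(_ _ e2) /= fI.
near \oo => n.
have [r [fr re rP]] : exists r : X -> R,
    [/\ finite_set (range r), simple_int mu r <= e / 2 &
      forall x a, `|a| <= M -> (a <= h x -> a <= f n x + r x) /\
                               (h x <= a -> f n x <= a + r x)].
  by near: n; exact: ds_determining_error.
have : `|I - simple_int mu (f n)| < e / 2.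
  have : `|I - fine (sintegral m (f n))| < e / 2 by near: n.
  by rewrite sintegral_simple_int.
have fnr := finite_image11 +%R (finite_range_fimfun (f n)) fr.
have := muS _ _ fg fnr (fun x => (rP x (g x) (gM x)).1 (gh x)).
by rewrite (simple_intD mu muU)// ltr_norml => ? /andP[? ?]; lra.
Unshelve. all: by end_near. Qed.

Lemma ds_limit_le f h g I : ds_determining m f h ->
  sintegral m (f n) @[n --> \oo] --> I%:E -> finite_set (range g) ->
  (forall x, h x <= g x) -> I <= simple_int mu g.
Proof.
move=> fh fI fg gh; have [M M0 gM] := finite_range_bound _ fg.
apply/ler_addgt0Pr => e e0; have e2 : 0 < e / 2 by lra.
move/fine_cvg/cvgrPdist_lt : fI => /(_ _ e2) /= fI.
near \oo => n.
have [r [fr re rP]] : exists r : X -> R,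
    [/\ finite_set (range r), simple_int mu r <= e / 2 &
      forall x a, `|a| <= M -> (a <= h x -> a <= f n x + r x) /\
                               (h x <= a -> f n x <= a + r x)].
  by near: n; exact: ds_determining_error.
have : `|I - simple_int mu (f n)| < e / 2.
  have : `|I - fine (sintegral m (f n))| < e / 2 by near: n.
  by rewrite sintegral_simple_int.
have fgr := finite_image11 +%R fg fr.
have := muS _ _ (finite_range_fimfun (f n)) fgr (fun x => (rP x (g x) (gM x)).2 (gh x)).
by rewrite (simple_intD mu muU)// ltr_norml => ? /andP[? ?]; lra.
Unshelve. all: by end_near. Qed.

(** Simple functions with [f n <= h <= f n + d n] and [d n] tending to 0 determine [h]. Their
    integrals lie within [d n] of the supremum of the integrals of simple minorants, which is
    therefore the limit. *)
Lemma bounded_ds_integrable h : bounded_fun h ->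
  exists I f, ds_determining m f h /\ sintegral m (f n) @[n --> \oo] --> I%:E.
Proof.
move=> hb.
have [d d0 d_small] : exists2 d : nat -> R, forall n, 0 < d n &
    forall e, 0 < e -> \forall n \near \oo, d n < e.
  exists (fun n => n.+1%:R^-1) => [n|e e0]; first by rewrite invr_gt0.
  exact: (near_infty_natSinv_lt (PosNum e0)).
have /choice[f fh] : forall n : nat, exists g : {fimfun X >-> R},
    forall x, g x <= h x <= g x + d n.
  move=> n; have [g [fg gh]] := simple_approx h (d n) hb (d0 n).
  by exists (fimfun_Sub (mem_set fg)).
have fS n : finite_set (range (f n)) by exact: finite_range_fimfun.
have fV n : finite_set (range (fun x => f n x + d n)).
  exact: (finite_image11 (fun x y => x + d n) (fS n) (fS n)).
have SV n : simple_int mu (fun x => f n x + d n) =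
    simple_int mu (f n) + d n.
  rewrite (simple_intD mu muU (f n) (fun=> d n))//; last exact: (finite_image_cst (d n)).
  by rewrite (simple_int_cst mu muU) muT mulr1.
pose E := [set simple_int mu g | g in
  [set g : X -> R | finite_set (range g) /\ forall x, g x <= h x]].
have Ef n : E (simple_int mu (f n)).
  by exists (f n) => //; split=> // x; have /andP[] := fh n x.
have ubE n : ubound E (simple_int mu (f n) + d n).
  move=> _ [g [fg gh] <-]; rewrite -SV; apply: muS => // x.
  by have /andP[_] := fh n x; apply: le_trans.
exists (sup E), f; split; last first.
  rewrite (_ : (fun n => _) = EFin \o (fun n => simple_int mu (f n))); last first.
    by apply/funext => n; rewrite sintegral_simple_int.
  apply: cvg_EFin; first exact: nearW.
  apply/cvgrPdist_lt => e e0; near=> n.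
  have ge : simple_int mu (f n) <= sup E.
    by apply: ub_le_sup => //; exists (simple_int mu (f 0%N) + d 0%N); exact: ubE.
  have le : sup E <= simple_int mu (f n) + d n.
    by apply: ge_sup; [exists (simple_int mu (f n))|exact: ubE].
  have : d n < e by near: n; exact: d_small.
  rewrite /= ger0_norm ?subr_ge0// => ne; apply: le_lt_trans ne.
  by rewrite lerBlDl.
split=> e e0.
  apply: cvg_near_cst; near=> n.
  have ne : d n < e by near: n; exact: d_small.
  (* Once [d n < e] the exceptional set is empty. *)
  rewrite [X in m X](_ : _ = set0) /m ?(mu_set0 mu muU)//.
  apply/seteqP; split=> x //=; have /andP[? ?] := fh n x.
  by rewrite ler0_norm; lra.
have e2 : 0 < e / 2 by lra.
exists ([set n | d n < e / 2], [set n | d n < e / 2]) => /=.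
  by split; exact: d_small.
move=> [n k] [/= ne ke].
have fnk : finite_set (range (fun x => `|f n x - f k x|)).
  exact: (finite_image11 (fun x y : R => `|x - y|)).
rewrite sintegral_simple_int// lte_fin.
(* Both functions lie below [h], by at most [d n] and [d k] respectively. *)
apply: (@le_lt_trans _ _ (Num.max (d n) (d k))); last first.
  by rewrite gt_max; apply/andP; split; lra.
rewrite -[leRHS]mulr1 -muT -(simple_int_cst mu muU); apply: muS => //.
  exact: finite_image_cst.
move=> x; have /andP[? ?] := fh n x; have /andP[? ?] := fh k x.
by rewrite ler_norml le_max lerNl le_max; apply/andP; split; apply/orP; [left|right]; lra.
Unshelve. all: by end_near. Qed.

(** Excludes the default branch of [xget] for bounded functions. *)
Lemma ds_integralP h : bounded_fun h -> exists2 f, ds_determining m f h &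
  sintegral m (f n) @[n --> \oo] --> (ds_integral m h)%:E.
Proof.
move=> /bounded_ds_integrable[I [f [fh fI]]].
have [] := @xgetPex _ 0 [set I : R | exists2 f, ds_determining m f h &
  sintegral m (f n) @[n --> \oo] --> I%:E]; first by exists I, f.
by move=> f' ? ?; exists f'.
Qed.

Lemma le_ds_integral g h : bounded_fun h -> finite_set (range g) ->
  (forall x, g x <= h x) -> simple_int mu g <= ds_integral m h.
Proof. by move=> /ds_integralP[f fh fI]; exact: ds_limit_ge fI. Qed.

Lemma ge_ds_integral g h : bounded_fun h -> finite_set (range g) ->
  (forall x, h x <= g x) -> ds_integral m h <= simple_int mu g.
Proof. by move=> /ds_integralP[f fh fI]; exact: ds_limit_le fI. Qed.

End ds_integral_simple_int.

(** * Sufficient subsets *)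

Section contents.
Context {X : pointedType} {R : realType}.

Lemma content_of_additive (mu : set X -> R) : (forall A, 0 <= mu A) ->
  (forall A B, A `&` B = set0 -> mu (A `|` B) = mu A + mu B) ->
  exists m : {content set (powersetType X) -> \bar R}, forall A, m A = (mu A)%:E.
Proof.
move=> mu_ge0 muU.
pose m : set (powersetType X) -> \bar R := fun A => (mu A)%:E.
have m_ge0 A : (0 <= m A)%E by rewrite lee_fin.
have mU : measure_function.semi_additive m.
  apply/additive2P; first by rewrite /m (mu_set0 mu muU).
  by move=> A B _ _ AB; rewrite /m muU.
pose mC := isContent.Build _ (powersetType X) R m m_ge0 mU.
pose mu' : {content set (powersetType X) -> \bar R} :=
  HB.pack_for {content set (powersetType X) -> \bar R} m mC.
by exists mu'.
Qed.

Lemma additive_of_content (m : {content set (powersetType X) -> \bar R}) :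
  m setT = 1%E -> exists mu : set X -> R,
  [/\ forall A, 0 <= mu A, forall A B, A `&` B = set0 -> mu (A `|` B) = mu A + mu B,
      mu setT = 1 & (m : set X -> \bar R) = fun A => (mu A)%:E].
Proof.
move=> mT.
have mU A B : A `&` B = set0 -> m (A `|` B) = (m A + m B)%E by exact: measureU.
have mfin A : m A \is a fin_num.
  rewrite ge0_fin_numE//; apply: (@le_lt_trans _ _ 1%E); last exact: ltry.
  by rewrite -mT -(setUv A) mU ?setICr// leeDl.
exists (fun A => fine (m A)); split.
- by move=> A; exact: fine_ge0.
- by move=> A B AB; rewrite mU// fineD.
- by rewrite mT.
- by apply/funext => A; rewrite fineK.
Qed.

End contents.

(** * From integrals to sufficiency *)

Section sufficient_of_integrals.
Context {X : pointedType} {R : realType} (mu : set X -> R).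
Context (mu_ge0 : forall A, 0 <= mu A).
Context (muU : forall A B, A `&` B = set0 -> mu (A `|` B) = mu A + mu B).
Context (muT : mu setT = 1).
Let m : set X -> \bar R := fun A => (mu A)%:E.

(** The one-sided form of linearity that is needed: add up simple minorants, each within [e] of its
    function and scaled by its weight. *)
Lemma ds_integral_lincomb (s : seq (X -> R)) (d : (X -> R) -> R) (e : R) :
  0 < e -> (forall h, h \in s -> 0 <= d h /\ bounded_fun h) ->
  exists g : X -> R, [/\ finite_set (range g),
    forall z, g z <= \sum_(h <- s) d h * h z &
    \sum_(h <- s) d h * ds_integral m h <= simple_int mu g + e * \sum_(h <- s) d h].
Proof.
move=> e0; elim: s => [_|h s IH hs].
  exists (fun=> 0); split; first exact: (finite_image_cst (0 : R)).
    by move=> z; rewrite big_nil.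
  by rewrite !big_nil (simple_int_cst mu muU); lra.
have [g [fg gs Ig]] := IH (fun h' h's => hs h' (mem_behead (s := h :: s) h's)).
have [d0 hb] := hs h (mem_head _ _).
have [u [fu uh]] := simple_approx h e hb e0.
have fdu : finite_set (range (fun z => d h * u z)).
  exact: (finite_image11 (fun x y => d h * x) fu fu).
exists (fun z => d h * u z + g z); split; first exact: (finite_image11 +%R fdu fg).
  move=> z; rewrite big_cons lerD// ler_wpM2l//.
  by have /andP[] := uh z.
have fue : finite_set (range (fun z => u z + e)).
  exact: (finite_image11 (fun x y => x + e) fu fu).
have := ge_ds_integral mu mu_ge0 muU muT _ _ hb fue (fun z => (andP (uh z)).2).
rewrite (simple_intD mu muU u (fun=> e))//; last exact: (finite_image_cst e).
rewrite (simple_int_cst mu muU) muT mulr1 => Ih.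
rewrite !big_cons (simple_intD mu muU _ _ fdu fg) (simple_intZ mu muU _ _ fu).
have := ler_wpM2l d0 Ih; rewrite /m; lra.
Qed.

(** A simple minorant of the combination is at most [c] on [Z], hence almost everywhere, so its
    integral is at most [c] because the total mass is 1. *)
Lemma lincomb_le_of_integrals (Z : set X) (s : seq (X -> R))
    (d : (X -> R) -> R) (x : X) (c : R) :
  (forall h, h \in s -> [/\ 0 <= d h, bounded_fun h & h x <= ds_integral m h]) ->
  mu (~` Z) = 0 -> (forall z, Z z -> \sum_(h <- s) d h * h z <= c) ->
  \sum_(h <- s) d h * h x <= c.
Proof.
move=> hs Z0 Zc; pose D := \sum_(h <- s) d h.
have D0 : 0 <= D by rewrite /D big_seq sumr_ge0// => h /hs[].
apply/ler_addgt0Pr => e e0.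
(* The approximation error gets multiplied by [D], which may be 0. *)
have e1 : 0 < e / (D + 1) by rewrite divr_gt0//; lra.
have [g [fg gs Ig]] := ds_integral_lincomb s d _ e1
  (fun h hs' => let: And3 a b _ := hs h hs' in conj a b).
have : simple_int mu g <= c.
  rewrite -[c]mulr1 -muT -(simple_int_cst mu muU); apply: ae_le_simple_int => //.
    exact: (finite_image_cst c).
  apply/eqP; rewrite eq_le mu_ge0 andbT -Z0; apply: (le_mu mu mu_ge0 muU) => z /= cg zZ.
  by have := lt_le_trans cg (gs z); rewrite ltNge Zc.
have : \sum_(h <- s) d h * h x <= \sum_(h <- s) d h * ds_integral m h.
  by rewrite big_seq [leRHS]big_seq ler_sum// => h /hs[dh _ hx]; exact: ler_wpM2l.
have : e / (D + 1) * D <= e.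
  by rewrite mulrAC ler_pdivrMr ?ler_pM2l//; lra.
move: Ig; rewrite -/D; lra.
Qed.

End sufficient_of_integrals.

Lemma fsum_seq {T : choiceType} {R : realType} (A : set T) (r : seq T)
    (F : T -> R) : uniq r -> (forall i, i \in r -> A i) ->
  (forall i, A i -> i \notin r -> F i = 0) ->
  \sum_(i \in A) F i = \sum_(i <- r) F i.
Proof.
move=> ur rA F0; rewrite (fsbigE r)// big_seq_cond [RHS]big_seq; apply: eq_bigl => i.
by rewrite andb_idr// => /rA/mem_set.
Qed.

(** * Convex weights and conic combinations *)

Section lincomb.
Context {X : pointedType} {R : realType} (H : set (X -> R)).
Implicit Types s : seq (R * (X -> R)).

Lemma weights_fsum (d F : (X -> R) -> R) : weights H d ->
  \sum_(h \in H) d h * F h =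
  \sum_(h <- fset_set [set h | H h /\ d h != 0]) d h * F h.
Proof.
move=> [_ fd _]; apply: fsum_seq => // h.
  by rewrite in_fset_set// => /set_mem[].
move=> Hh; rewrite in_fset_set// => hd; apply/eqP; rewrite mulf_eq0.
by apply/orP; left; apply: contraNT hd => dh; apply: mem_set.
Qed.

(** Lists of coefficients and functions, repetitions allowed, encode the cone: concatenation is
    addition, and rescaling the coefficients is scalar multiplication. *)
Definition cone_comb s := forall p, p \in s -> 0 <= p.1 /\ H p.2.

(** Merge the coefficients of equal functions and divide by the total. The arbitrary [F] covers
    evaluation at any point, and [F = 1] gives total weight 1. *)
Lemma cone_comb_weights s : cone_comb s -> 0 < \sum_(p <- s) p.1 ->
  exists2 d, weights H d & forall F : (X -> R) -> R,
    \sum_(h \in H) d h * F h = (\sum_(p <- s) p.1 * F p.2) / \sum_(p <- s) p.1.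
Proof.
move=> sH; set D := \sum_(p <- s) p.1 => D0.
pose d h := (\sum_(p <- s | p.2 == h) p.1) / D.
have ds h : d h != 0 -> h \in undup (map snd s).
  apply: contraR; rewrite mem_undup => hs; rewrite /d big_seq_cond big_pred0 ?mul0r//.
  move=> p; apply/negP => /andP[ps /eqP ph]; move/negP: hs; apply.
  by rewrite -ph; exact: map_f.
have dF (F : (X -> R) -> R) :
    \sum_(h \in H) d h * F h = (\sum_(p <- s) p.1 * F p.2) / D.
  rewrite (fsum_seq _ (undup (map snd s))) ?undup_uniq//; last 2 first.
  - by move=> h; rewrite mem_undup => /mapP[p /sH[_ Hp] ->].
  - move=> h _ hs; apply/eqP; rewrite mulf_eq0; apply/orP; left.
    by apply: contraNT hs; exact: ds.
  under eq_bigr do rewrite /d mulrAC big_distrl/=.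
  rewrite -mulr_suml; congr (_ / _).
  rewrite (exchange_big_dep xpredT)//= big_seq [RHS]big_seq; apply: eq_bigr => p ps.
  rewrite -big_filter (eq_filter (a2 := pred1 p.2)); last first.
    by move=> h /=; rewrite eq_sym.
  by rewrite filter_pred1_uniq ?undup_uniq ?big_seq1// mem_undup map_f.
exists d => //; split.
- move=> h _; rewrite divr_ge0 ?(ltW D0)// big_seq_cond.
  by apply: sumr_ge0 => p /andP[/sH[]].
- apply: (sub_finite_set _ (finite_seq (undup (map snd s)))) => h [_].
  exact: ds.
- under eq_fsbigr do rewrite -[d _]mulr1.
  by rewrite (dF (fun=> 1)); under eq_bigr do rewrite mulr1; rewrite divff ?gt_eqF.
Qed.

(** A single function of [H] carries a weight, and over an empty [Z] the supremum would be [-oo]. *)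
Lemma sufficient_nonempty Z : H !=set0 -> sufficient H Z -> Z !=set0.
Proof.
move=> [h Hh] HZ; apply/set0P/eqP => Z0.
have [|/=|d wd _] := @cone_comb_weights [:: (1, h)].
- by move=> p; rewrite inE => /eqP ->.
- by rewrite big_seq1.
by have := HZ point d wd; rewrite Z0 image_set0 ereal_sup0 leNgt ltNyr.
Qed.

(** For total coefficient [D > 0], normalize and apply sufficiency. For [D = 0] all coefficients
    vanish, and the bound at a point of [Z] reads [0 <= c]. *)
Lemma sufficient_cone_comb Z s (x : X) (c : R) : Z !=set0 -> sufficient H Z ->
  cone_comb s -> (forall z, Z z -> \sum_(p <- s) p.1 * (p.2 z - p.2 x) <= c) ->
  0 <= c.
Proof.
move=> [z0 Zz0] HZ sH Zc; pose D := \sum_(p <- s) p.1.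
have s0 p : p \in s -> 0 <= p.1 by move=> /sH[].
have : 0 <= D by rewrite /D big_seq sumr_ge0.
rewrite le_eqVlt => /orP[/eqP D0|D0].
  have p0 p : p \in s -> p.1 = 0.
    move: D0 => /esym; rewrite /D big_seq_cond => /eqP; rewrite psumr_eq0; last first.
      by move=> i /andP[/s0].
    by move=> /allP + ps => /(_ _ ps)/implyP; rewrite ps => /(_ isT)/eqP.
  apply: le_trans (Zc _ Zz0); rewrite big_seq big1// => p /p0 ->.
  by rewrite mul0r.
have [d wd dF] := cone_comb_weights s sH D0.
have := HZ x d wd; rewrite (dF (fun h => h x)).
pose B := (c + \sum_(p <- s) p.1 * p.2 x) / D.
have le_B : (ereal_sup [set (\sum_(h \in H) d h * h z)%:E | z in Z] <= B%:E)%E.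
  apply: ge_ereal_sup => _ [z Zz <-]; rewrite lee_fin (dF (fun h => h z)).
  rewrite ler_pM2r ?invr_gt0// -lerBlDr -sumrB.
  by under eq_bigr do rewrite -mulrBr; exact: Zc.
move=> /le_trans/(_ le_B); rewrite lee_fin ler_pM2r ?invr_gt0//; lra.
Qed.

End lincomb.

(** * The sublinear functional and the measure it yields *)

Section upper_functional.
Context {X : pointedType} {R : realType} (H : set (X -> R)) (ZZ : set (set X)).
Context (ZZ_chain : total_on ZZ (fun A B => A `<=` B)) (x : X).
Context (ZZT : ZZ setT).
Context (ZZ0 : forall Z, ZZ Z -> Z !=set0) (HZZ : forall Z, ZZ Z -> sufficient H Z).
Local Notation V := {fimfun X >-> R}.
Implicit Types (u v : V) (s : seq (R * (X -> R))).

(** Collecting all upper bounds [c] avoids a separate supremum over [Z] under the infimum. *)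
Definition upper_values u := [set c | exists Z s,
  [/\ ZZ Z, cone_comb H s &
    forall z, Z z -> u z + \sum_(p <- s) p.1 * (p.2 z - p.2 x) <= c]].

Definition upper_functional u := inf (upper_values u).

(** Sufficiency enters here: as [u >= - M], the conic combination is at most [c + M] on [Z]. *)
Lemma upper_values_lbound u : has_lbound (upper_values u).
Proof.
have [M M0 uM] := finite_range_bound u (fimfun_inP _ _).
exists (- M) => c [Z [s [ZZZ sH Zc]]].
suff : 0 <= c + M by lra.
apply: (@sufficient_cone_comb _ _ H Z s x) => //; [exact: ZZ0|exact: HZZ|].
by move=> z Zz; have := Zc z Zz; have := uM z; rewrite ler_norml => /andP[? ?]; lra.
Qed.

Lemma upper_functional_le u c : upper_values u c -> upper_functional u <= c.
Proof. exact: ge_inf (upper_values_lbound u) _. Qed.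

Lemma upper_functional_le_sup u Z c : ZZ Z -> (forall z, Z z -> u z <= c) ->
  upper_functional u <= c.
Proof.
move=> ZZZ uc; apply: upper_functional_le; exists Z, [::]; split => // z Zz.
by rewrite big_nil addr0 uc.
Qed.

Lemma upper_values_neq0 u : upper_values u !=set0.
Proof.
have [M M0 uM] := finite_range_bound u (fimfun_inP _ _).
exists M, setT, [::]; split => // z _.
by rewrite big_nil addr0 (le_trans (ler_norm _)).
Qed.

Lemma sublinear_upper_functional : sublinear upper_functional.
Proof.
split.
  move=> u v; rewrite -lerBlDl; apply: lb_le_inf; first exact: upper_values_neq0.
  move=> c2 [Z2 [s2 [ZZ2 H2 Zc2]]]; rewrite lerBlDl -lerBlDr.
  apply: lb_le_inf; first exact: upper_values_neq0.
  move=> c1 [Z1 [s1 [ZZ1 H1 Zc1]]]; rewrite lerBlDr; apply: upper_functional_le.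
  (* Both bounds hold on the smaller of the two sets. *)
  have [Z [ZZZ Z1Z Z2Z]] : exists Z, [/\ ZZ Z, Z `<=` Z1 & Z `<=` Z2].
    by have [Z12|Z21] := ZZ_chain _ _ ZZ1 ZZ2; [exists Z1|exists Z2]; split=> // ?.
  exists Z, (s1 ++ s2); split => //.
    by move=> p; rewrite mem_cat => /orP[/H1|/H2].
  move=> z Zz; have -> : (u + v) z = u z + v z by [].
  rewrite big_cat/= addrACA.
  by apply: lerD; [exact/Zc1/Z1Z|exact/Zc2/Z2Z].
move=> k u k0; rewrite -ler_pdivrMl//; apply: lb_le_inf; first exact: upper_values_neq0.
move=> c [Z [s [ZZZ sH Zc]]]; rewrite ler_pdivrMl//; apply: upper_functional_le.
exists Z, [seq (k * p.1, p.2) | p <- s]; split => //.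
  by move=> _ /mapP[p /sH[p0 Hp] ->]; split=> //=; rewrite mulr_ge0// ltW.
move=> z Zz; have -> : (k *: u) z = k * u z by [].
rewrite big_map/=; under eq_bigr do rewrite -mulrA.
by rewrite -mulr_sumr -mulrDr ler_pM2l// Zc.
Qed.

(** The last clause speaks of simple majorants only, since [phi] lives on simple functions;
    approximation later replaces them by [ds_integral]. *)
Lemma exists_additive_extension : exists mu : set X -> R,
  [/\ forall A, 0 <= mu A,
      forall A B, A `&` B = set0 -> mu (A `|` B) = mu A + mu B,
      mu setT = 1, forall Z, ZZ Z -> mu (~` Z) = 0 &
      forall h (g : V), H h -> (forall z, h z <= g z) -> h x <= simple_int mu g].
Proof.
have [phi [phiL phi_le]] := hahn_banach _ sublinear_upper_functional.
have phiD u v : phi (u + v) = phi u + phi v.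
  by have := phiL 1 u v; rewrite scale1r mul1r.
have phi0 : phi 0 = 0 by have := phiD 0 0; rewrite addr0; lra.
have phiZ c u : phi (c *: u) = c * phi u.
  by have := phiL c u 0; rewrite addr0 phi0 addr0.
have phiN u : phi (- u) = - phi u by rewrite -scaleN1r phiZ mulN1r.
have phi_ge0 u : (forall z, 0 <= u z) -> 0 <= phi u.
  move=> u0; rewrite -oppr_le0 -phiN; apply: le_trans (phi_le _) _.
  apply: (upper_functional_le_sup _ setT) => // z _.
  have -> : (- u) z = - u z by [].
  by rewrite oppr_le0.
pose mu A := phi (indic_fimfun A).
have mu_ge0 A : 0 <= mu A by apply: phi_ge0 => z; rewrite /= indicE.
have muU A B : A `&` B = set0 -> mu (A `|` B) = mu A + mu B.
  move=> AB; rewrite /mu -phiD; congr phi; apply/fimfuneqP => z.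
  have -> : (indic_fimfun A + indic_fimfun B : V) z = \1_A z + \1_B z by [].
  rewrite /=.
  rewrite !indicE in_setU -natrD; congr (_%:R).
  have [zA|zA] := boolP (z \in A); have [zB|zB] := boolP (z \in B) => //.
  by have : (A `&` B) z by [split; exact: set_mem]; rewrite AB.
have muZ Z : ZZ Z -> mu (~` Z) = 0.
  move=> ZZZ; apply/eqP; rewrite eq_le mu_ge0 andbT.
  apply: le_trans (phi_le _) _; apply: (upper_functional_le_sup _ Z) => // z Zz.
  by rewrite /= indicE memNset.
have muT : mu setT = 1.
  apply/eqP; rewrite eq_le; apply/andP; split.
    apply: le_trans (phi_le _) _; apply: (upper_functional_le_sup _ setT) => // z _.
    by rewrite /= indicE mem_set.
  rewrite -lerN2 -phiN; apply: le_trans (phi_le _) _.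
  apply: (upper_functional_le_sup _ setT) => // z _.
  have -> : (- indic_fimfun setT : V) z = - \1_setT z by [].
  by rewrite indicE mem_set.
(* Write [g] as a combination of the indicators of its fibres. *)
have phiS (g : V) : simple_int mu g = phi g.
  have gE : g = \sum_(y <- fset_set (range g)) y *: indic_fimfun (g @^-1` [set y]).
    by apply/fimfuneqP => z; rewrite fimfun_sum fimfunE fsbig_finite//.
  rewrite [in RHS]gE (big_morph phi phiD phi0).
  by apply: eq_bigr => y _; rewrite phiZ.
exists mu; split => // h g Hh hg; rewrite phiS -lerN2 -phiN.
apply: le_trans (phi_le _) _; apply: upper_functional_le.
exists setT, [:: (1, h)]; split => //.
  by move=> p; rewrite inE => /eqP ->.
move=> z _; have -> : (- g) z = - g z by [].
by rewrite big_seq1/= mul1r; have := hg z; lra.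
Qed.

End upper_functional.

(** * The equivalence *)

Theorem theorem5 (R : realType) (X : pointedType) (H : set (X -> R))
    (H_nonempty : H !=set0)
    (H_bounded : forall h, H h -> bounded_fun h)
    (ZZ : set (set X))
    (ZZ_chain : total_on ZZ (fun A B => A `<=` B)) :
  (forall Z, ZZ Z -> sufficient H Z) <->
  (forall x : X, exists m : {content set (powersetType X) -> \bar R},
     [/\ fa_probability H m,
         forall Z, ZZ Z -> m (~` Z) = 0%E &
         forall h, H h -> h x <= ds_integral m h]).
Proof.
split=> [HZZ x|Hm Z ZZZ x d wd].
  (* The whole space is trivially sufficient and keeps the family a chain. It makes the upper values
     nonempty even when [ZZ] is empty. *)
  pose ZZT := ZZ `|` [set setT].
  have HT : sufficient H setT.
    by move=> y d wd; apply: ereal_sup_ubound; exists y.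
  have HZZT Z : ZZT Z -> sufficient H Z by case=> [/HZZ//|->].
  have chainT : total_on ZZT (fun A B => A `<=` B).
    move=> A B [ZA|->]; last by right.
    by case=> [ZB|->]; [exact: ZZ_chain|left].
  have [mu [mu_ge0 muU muT muZ muH]] := @exists_additive_extension _ _ H ZZT
    chainT x (or_intror erefl)
    (fun Z ZZZ => sufficient_nonempty H Z H_nonempty (HZZT Z ZZZ)) HZZT.
  have [m mE] := content_of_additive mu mu_ge0 muU.
  have mEf : (m : set X -> \bar R) = fun A => (mu A)%:E by apply/funext => A; exact: mE.
  exists m; split.
  - split; first by rewrite mE muT.
    move=> h /H_bounded hb.
    have [I [f [fh _]]] := bounded_ds_integrable mu mu_ge0 muU muT h hb.
    by exists f; rewrite mEf.
  - by move=> Z ZZZ; rewrite mE muZ//; left.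
  - move=> h Hh; rewrite mEf; apply/ler_addgt0Pr => e e0.
    (* The majorant [g + e] bounds [h x], the minorant [g] bounds the integral from below, and their
       integrals differ by [e]. *)
    have [g [fg gh]] := simple_approx h e (H_bounded h Hh) e0.
    have fge : finite_set (range (fun z => g z + e)).
      exact: (finite_image11 (fun x y => x + e) fg fg).
    have := muH h (fimfun_Sub (mem_set fge)) Hh (fun z => (andP (gh z)).2).
    rewrite /= (simple_intD mu muU g (fun=> e))//; last exact: (finite_image_cst e).
    rewrite (simple_int_cst mu muU) muT.
    have := le_ds_integral mu mu_ge0 muU muT g h (H_bounded h Hh) fg
      (fun z => (andP (gh z)).1).
    lra.
have [m [[mT mH] mZ hm]] := Hm x.
have [mu [mu_ge0 muU muT mEf]] := additive_of_content m mT.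
have [d0 fd _] := wd.
have claim c : (forall z, Z z -> \sum_(h \in H) d h * h z <= c) ->
    \sum_(h \in H) d h * h x <= c.
  move=> Zc; rewrite (weights_fsum H d (fun h => h x) wd).
  apply: (lincomb_le_of_integrals mu mu_ge0 muU muT Z).
  - move=> h; rewrite in_fset_set// => /set_mem[Hh _].
    by split; [exact: d0|exact: H_bounded|rewrite -mEf; exact: hm].
  - have : (m : set X -> \bar R) (~` Z) = 0%E by exact: mZ.
    by rewrite mEf => -[].
  - by move=> z Zz; rewrite -(weights_fsum H d (fun h => h z) wd) Zc.
have supP z : Z z -> ((\sum_(h \in H) d h * h z)%:E <=
    ereal_sup [set (\sum_(h \in H) d h * h z)%R%:E | z in Z])%E.
  by move=> Zz; apply: ereal_sup_ubound; exists z.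
move: supP; case: ereal_sup => [c| |] supP; [|by rewrite leey|].
  by rewrite lee_fin; apply: claim => z /supP; rewrite lee_fin.
(* If the supremum is [-oo], every real number bounds the combination on [Z]; its value at [x] minus
   1 gives a contradiction. *)
have /claim : forall z, Z z ->
    \sum_(h \in H) d h * h z <= \sum_(h \in H) d h * h x - 1.
  by move=> z /supP; rewrite leNgt ltNyr.
by rewrite lerDl oppr_ge0 ler10.
Qed.
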